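(* Let $b,\sigma,f,g$ be coefficients satisfying all of the following conditions. (Condition on $b$) There is a constant $C_b>0$ such that for all $x,y\in\mathbb{R}^d$, $|b(x)-b(y)|\le C_b|x-y|\log(|x-y|^{-1}+e)$. (Condition on $\sigma$) There is a constant $C_\sigma>0$ such that for all $x,y\in\mathbb{R}^d$, $|\sigma(x)-\sigma(y)|^2\le C_\sigma|x-y|^2\log(|x-y|^{-1}+e)$. (Condition on $f$) There is a positive function $L$ on $\mathbb{U}_0$ with $\sup_{u\in\mathbb{U}_0}L(u)\le\delta<1$ and $\int_{\mathbb{U}_0}L(u)^2\,n(du)<\infty$ such that for all $x,y\in\mathbb{R}^d$ and $u\in\mathbb{U}_0$, $|f(x,u)-f(y,u)|\le L(u)|x-y|$ and $|f(0,u)|\le L(u)$; moreover, for some $q>4d$, $\frac{q\delta}{(1-\delta)^{q+1}}<1$. (Condition on $g$) For each $u\in\mathbb{U}\setminus\mathbb{U}_0$, the map $x\mapsto x+g(x,u)$ is a homeomorphism of $\mathbb{R}^d$ onto $\mathbb{R}^d$. Let $X_t(x)$ be the unique strong solution of $$X_t(x)=x+\int_0^t b(X_s(x))\,ds+\int_0^t\sigma(X_s(x))\,dW_s+\int_0^{t+}\!\!\int_{\mathbb{U}_0}f(X_{s-}(x),u)\,\tilde N_k(ds,du)+\int_0^{t+}\!\!\int_{\mathbb{U}\setminus\mathbb{U}_0}g(X_{s-}(x),u)\,N_k(ds,du),\quad t\ge0,$$ and set $\varphi(t,\omega)x:=X_t(x,\omega)$. If $\mu$ is an invariant Markov measure of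 the skew product flow $\Theta_t(\omega,x)=(\theta_t\omega,\varphi(t,\omega)x)$ on $\Omega\times\mathbb{R}^d$, with factorization $\mu(d\omega,dx)=\mu_\omega(dx)\,\mathbb{P}(d\omega)$, then $\bar\mu:=\mathbb{E}(\mu_\cdot\,|\,\mathscr{F}_{>0})$ is a stationary measure for $p_t$.
   Context: Setting: $(\mathbb{U},\mathcal{U},n)$ is a $\sigma$-finite measure space and $\mathbb{U}_0\in\mathcal{U}$ is fixed with $n(\mathbb{U}\setminus\mathbb{U}_0)<\infty$. On $(\Omega,\mathscr{F},\mathbb{P})$, $W$ is an $m$-dimensional standard Brownian motion and $k$ a stationary Poisson point process (independent of $W$) with values in $\mathbb{U}$ and characteristic measure $n$; $N_k((0,t],A)=\#\{0<s\le t:k_s\in A\}$ is its counting measure and $\tilde N_k((0,t],du)=N_k((0,t],du)-t\,n(du)$. The coefficients are measurable maps $b:\mathbb{R}^d\to\mathbb{R}^d$, $\sigma:\mathbb{R}^d\to\mathbb{R}^{d\times m}$, $f,g:\mathbb{R}^d\times\mathbb{U}\to\mathbb{R}^d$. Expressions such as $|x-y|\log(|x-y|^{-1}+e)$ are read as $0$ when $x=y$. $(\theta_t)_{t\ge0}$ is a family of measurable $\mathbb{P}$-preserving, ergodic transformations of $\Omega$ (the time shifts of the driving noise: $W_s(\theta_t\omega)=W_{t+s}(\omega)-W_t(\omega)$ and $N_k((0,s],A)(\theta_t\omega)=N_k((t,t+s],A)(\omega)$). Under the stated conditions $\varphi$ is a measurable c\`adl\`ag random dynamical system over $\theta$: it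 is jointly measurable, each $\varphi(t,\omega)$ is a homeomorphism of $\mathbb{R}^d$, $t\mapsto\varphi(t,\omega)$ is c\`adl\`ag, $\varphi(0,\omega)=\mathrm{id}$ and $\varphi(t+s,\omega)=\varphi(t,\theta_s\omega)\circ\varphi(s,\omega)$. $\sigma$-algebras: $\mathscr{F}_{\le t}=\sigma\{W_s,N_k((0,s],B):s\le t,B\in\mathcal{U}\}$, $\mathscr{F}_{\geq t}=\sigma\{W_s,N_k((0,s],B):s\ge t,B\in\mathcal{U}\}$, $\mathscr{F}_{>t}=\sigma\{W_s,N_k((0,s],B):s>t,B\in\mathcal{U}\}$, $\mathscr{F}_{<\infty}=\sigma\{W_s,N_k((0,s],B):s<\infty,B\in\mathcal{U}\}$, $\mathscr{F}_{=0}=\mathscr{F}_{\le0}$. $X_t(x)$ is $\mathscr{F}_{\le t}$-measurable and independent of $\theta_t^{-1}\mathscr{F}_{>0}$, and $\mathscr{F}_{=0}$ is independent of $\mathscr{F}_{>0}$. A probability measure $\mu$ on $(\Omega\times\mathbb{R}^d,\mathscr{F}\otimes\mathscr{B}(\mathbb{R}^d))$ is invariant for $\Theta_t$ if its marginal on $\Omega$ is $\mathbb{P}$ and $\Theta_t\mu=\mu$ (image measure) for all $t\ge0$; equivalently $\mathbb{E}[\varphi(t,\cdot)\mu_\cdot\,|\,\theta_t^{-1}\mathscr{F}](\omega)=\mu_{\theta_t\omega}$ $\mathbb{P}$-a.s. for all $t\geq 0$. It is a Markov measure if $\mathbb{E}(\mu_\cdot\,|\,\mathscr{F}_{<\infty})=\mathbb{E}(\mu_\cdot\,|\,\mathscr{F}_{=0})$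 $\mathbb{P}$-a.s. Here $\mu_\omega$ is the probability kernel in the factorization of $\mu$, and conditional expectations of random measures are taken setwise. $p_t(x,B)=\mathbb{P}(X_t(x)\in B)$, and a measure $\bar\mu$ on $(\mathbb{R}^d,\mathscr{B}(\mathbb{R}^d))$ is a stationary measure for $p_t$ if $\int_{\mathbb{R}^d}p_t(x,B)\,\bar\mu(dx)=\bar\mu(B)$ for all $t>0$ and $B\in\mathscr{B}(\mathbb{R}^d)$. *)

(* Defs.v *)
From HB Require Import structures.
From mathcomp Require Import all_boot all_order all_algebra.
From mathcomp Require Import all_classical all_reals all_analysis.
From mathcomp Require Import measurable_realfun.

Set Implicit Arguments.
Unset Strict Implicit.
Unset Printing Implicit Defensive.
Import Order.TTheory GRing.Theory Num.Theory.
Import numFieldNormedType.Exports.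

Local Open Scope classical_set_scope.
Local Open Scope ring_scope.

(* Borel sigma-algebra on matrices; R^d is 'rV[R]_d. *)
Definition borel_mx_display : measure_display.
Proof. exact: default_measure_display. Qed.

Section borel_matrix.
Context (R : realType) (p q : nat).

Let borel_mx : set (set 'M[R]_(p, q)) := <<s @open 'M[R]_(p, q) >>.

HB.instance Definition _ := @isMeasurable.Build borel_mx_display 'M[R]_(p, q)
  borel_mx (@sigma_algebra0 _ setT _)
  (@sigma_algebraC _ (@open 'M[R]_(p, q)))
  (@sigma_algebra_bigcup _ setT _).

End borel_matrix.

(* Euclidean norm of a row vector and Hilbert-Schmidt norm of a matrix; the
   library norm `|_| on matrices is the sup norm. *)
Definition enorm (R : realType) (p q : nat) (A : 'M[R]_(p, q)) : R :=
  Num.sqrt (\sum_i \sum_j A i j ^+ 2).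

Definition homeomorphism (T T' : topologicalType) (h : T -> T') : Prop :=
  continuous h /\ exists h', [/\ continuous h', cancel h h' & cancel h' h].

Definition cadlag (R : realType) (V : ptopologicalType) (h : R -> V) : Prop :=
  forall t, 0 <= t ->
    (h s @[s --> t^'+] --> h t) /\ (0 < t -> cvg (h s @[s --> t^'-])).

Definition left_lim (R : realType) (d : nat) (h : R -> 'rV[R]_d) (t : R) :
  'rV[R]_d := lim (h s @[s --> t^'-]).

Section coefficient_conditions.
Context (R : realType) (d m : nat) (dU : measure_display)
  (U : measurableType dU) (n : {measure set U -> \bar R}) (U0 : set U).

(* At x = y, 0^-1 = 0 makes the right-hand sides 0. *)
Definition cond_b (b : 'rV[R]_d -> 'rV[R]_d) : Prop :=
  exists2 C : R, 0 < C & forall x y,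
    enorm (b x - b y) <=
      C * enorm (x - y) * ln ((enorm (x - y))^-1 + expR 1).

Definition cond_sigma (sigma : 'rV[R]_d -> 'M[R]_(d, m)) : Prop :=
  exists2 C : R, 0 < C & forall x y,
    enorm (sigma x - sigma y) ^+ 2 <=
      C * enorm (x - y) ^+ 2 * ln ((enorm (x - y))^-1 + expR 1).

Definition cond_f (f : 'rV[R]_d -> U -> 'rV[R]_d) : Prop :=
  exists (L : U -> R) (delta : R),
    (forall u, U0 u -> 0 < L u) /\
    (forall u, U0 u -> L u <= delta) /\ delta < 1 /\
    measurable_fun U0 L /\
    (\int[n]_(u in U0) ((L u) ^+ 2)%:E < +oo)%E /\
    (forall x y u, U0 u -> enorm (f x u - f y u) <= L u * enorm (x - y)) /\
    (forall u, U0 u -> enorm (f 0 u) <= L u) /\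
    (exists2 q : R, (4 * d)%N%:R < q &
       q * delta / (1 - delta) `^ (q + 1) < 1).

Definition cond_g (g : 'rV[R]_d -> U -> 'rV[R]_d) : Prop :=
  forall u, ~ U0 u -> homeomorphism (fun x : 'rV[R]_d => x + g x u).

End coefficient_conditions.

Section random.
Context (R : realType) (dO : measure_display) (Omega : measurableType dO)
  (P : probability Omega R).

Definition sub_measurable (d' : measure_display) (T : measurableType d')
    (G : set (set Omega)) (Y : Omega -> T) : Prop :=
  forall A, measurable A -> G (Y @^-1` A).

Definition augment (G : set (set Omega)) : set (set Omega) :=
  [set A | measurable A /\ exists2 B, G B & P.-negligible (A `+` B)].

Definition mutually_independent (I : finType) (d' : measure_display)
    (T : measurableType d') (Y : I -> Omega -> T) : Prop :=
  forall A : I -> set T, (forall i, measurable (A i)) ->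
    P (\bigcap_i (Y i @^-1` A i)) = (\prod_i P (Y i @^-1` A i))%E.

Definition independent_sigma (G H : set (set Omega)) : Prop :=
  forall A B, G A -> H B -> P (A `&` B) = (P A * P B)%E.

(* The Z j are meant to be nonnegative. *)
Definition cvg0_in_prob (Z : nat -> Omega -> \bar R) : Prop :=
  forall e : R, 0 < e -> P [set w | (e%:E <= Z j w)%E] @[j --> \oo] --> 0%E.

(* Y is a version of the conditional expectation of Z given G. *)
Definition is_condexp (G : set (set Omega)) (Z Y : Omega -> \bar R) : Prop :=
  [/\ sub_measurable G Y, P.-integrable setT Y &
      forall A, G A ->
        (\int[P]_(w in A) Y w = \int[P]_(w in A) Z w)%E].

Definition is_condexp_measure (d' : measure_display) (T : measurableType d')
    (G : set (set Omega)) (M N : Omega -> set T -> \bar R) : Prop :=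
  forall B, measurable B -> is_condexp G (M ^~ B) (N ^~ B).

Section noise.
Context (m : nat) (dU : measure_display) (U : measurableType dU)
  (n : {sigma_finite_measure set U -> \bar R}).

Record standard_brownian (W : R -> Omega -> 'rV[R]_m) : Prop := {
  bm_measurable : forall t, 0 <= t -> measurable_fun setT (W t);
  bm_start : {ae P, forall w, W 0 w = 0};
  bm_continuous :
    {ae P, forall w, {within `[0, +oo[, continuous (fun t => W t w)}};
  bm_law : forall s t (j : 'I_m), 0 <= s -> s < t ->
    forall A : set R, measurable A ->
      P [set w | A (W t w 0 j - W s w 0 j)] =
      normal_prob 0 (Num.sqrt (t - s)) A;
  bm_increments : forall (p : nat) (t : nat -> R),
    0 <= t 0%N -> (forall i, t i < t i.+1) ->
    mutually_independent (fun (ij : 'I_p * 'I_m) w =>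
      W (t ij.1.+1) w 0 ij.2 - W (t ij.1) w 0 ij.2) }.

(* A point process is k : R -> Omega -> option U, where k s w = None when s is
   outside the (countable) domain; only times s > 0 matter. Its counting
   measure on ]0, +oo[ x U: *)
Definition counting_pp (k : R -> Omega -> option U) (w : Omega)
    (B : set (R * U)) : \bar R :=
  counting [set s : R | 0 < s /\ exists2 u, k s w = Some u & B (s, u)].

Record stationary_poisson (k : R -> Omega -> option U) : Prop := {
  pp_countable : forall w, countable [set s : R | 0 < s /\ k s w <> None];
  pp_measurable : forall B : set (R * U), measurable B ->
    measurable_fun setT (fun w => counting_pp k w B);
  (* the second argument of poisson_prob is a dummy *)
  pp_law : forall B : set (R * U), measurable B ->
    B `<=` `]0, +oo[ `*` setT ->
    ((lebesgue_measure \x n)%E B < +oo)%E -> forall j : nat,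
      P [set w | counting_pp k w B = j%:R%:E] =
      poisson_prob (fine ((lebesgue_measure \x n)%E B)) 0 [set j];
  pp_law_infty : forall B : set (R * U), measurable B ->
    B `<=` `]0, +oo[ `*` setT ->
    (lebesgue_measure \x n)%E B = +oo%E ->
      {ae P, forall w, counting_pp k w B = +oo%E};
  pp_independent : forall (p : nat) (B : 'I_p -> set (R * U)),
    (forall i, measurable (B i)) -> trivIset setT B ->
    mutually_independent (fun i w => counting_pp k w (B i)) }.

Definition gen_W (W : R -> Omega -> 'rV[R]_m) (T : set R) : set (set Omega) :=
  [set E | exists2 s, T s & exists2 A, measurable A & E = W s @^-1` A].

Definition gen_N (k : R -> Omega -> option U) (T : set R) : set (set Omega) :=
  [set E | exists2 s, T s & exists2 B : set U, measurable B &
     exists2 C, measurable C &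
     E = (fun w => counting_pp k w (`]0, s] `*` B)) @^-1` C].

(* sigma{ W_s, N((0,s], B) : s in T, B measurable } *)
Definition noise_sigma (W : R -> Omega -> 'rV[R]_m)
    (k : R -> Omega -> option U) (T : set R) : set (set Omega) :=
  <<s gen_W W T `|` gen_N k T >>.

Definition independent_noise (W : R -> Omega -> 'rV[R]_m)
    (k : R -> Omega -> option U) : Prop :=
  independent_sigma <<s gen_W W `[0, +oo[ >> <<s gen_N k `[0, +oo[ >>.

(* Ergodicity is that of the whole family: sets invariant under every theta_t
   are trivial. *)
Record noise_shift (W : R -> Omega -> 'rV[R]_m) (k : R -> Omega -> option U)
    (theta : R -> Omega -> Omega) : Prop := {
  shift_measurable : forall t, 0 <= t -> measurable_fun setT (theta t);
  shift_preserving : forall t, 0 <= t -> forall A, measurable A ->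
    pushforward P (theta t) A = P A;
  shift_ergodic : forall A, measurable A ->
    (forall t, 0 <= t -> theta t @^-1` A = A) -> P A = 0%E \/ P A = 1%E;
  shift_W : forall s t w, 0 <= s -> 0 <= t ->
    W s (theta t w) = W (t + s) w - W t w;
  shift_N : forall s t w (A : set U), 0 <= s -> 0 <= t -> measurable A ->
    counting_pp k (theta t w) (`]0, s] `*` A) =
    counting_pp k w (`]t, t + s] `*` A) }.

(* Stochastic integrals: limits in probability of integrals of elementary
   predictable processes  sum_i xi_i 1_{]a_i, b_i]}  (times 1_{A_i}(u) for
   random measures). F is the filtration. *)
Record step := Step { coef : Omega -> R; from : R; upto : R }.

Definition admissible (F : R -> set (set Omega)) (h : step) : Prop :=
  [/\ 0 <= from h, from h <= upto h, sub_measurable (F (from h)) (coef h) &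
      exists M : R, forall w, `|coef h w| <= M].

Definition step_val (h : step) (s : R) (w : Omega) : R :=
  coef h w * \1_(`]from h, upto h]) s.

(* J is a version of int_0^t H_s dB_s. *)
Definition ito_integral (F : R -> set (set Omega)) (B : R -> Omega -> R)
    (H : R -> Omega -> R) (t : R) (J : Omega -> R) : Prop :=
  measurable_fun setT J /\
  exists (p : nat -> nat) (h : forall j, 'I_(p j) -> step),
    [/\ forall j i, admissible F (h j i),
        cvg0_in_prob (fun j w => \int[lebesgue_measure]_(s in `[0%R, t])
          ((\sum_(i < p j) step_val (h j i) s w - H s w) ^+ 2)%:E)%E &
        cvg0_in_prob (fun j w => `|\sum_(i < p j) coef (h j i) w *
          (B (Num.min (upto (h j i)) t) w - B (Num.min (from (h j i)) t) w)
          - J w|%:E)].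

Definition compensated_pp (k : R -> Omega -> option U) (a b : R) (A : set U)
    (w : Omega) : R :=
  fine (counting_pp k w (`]a, b] `*` A)) - (b - a) * fine (n A).

(* J is a version of int_0^{t+} int_{U0} H(s, u) Ntilde(ds, du). *)
Definition compensated_integral (F : R -> set (set Omega))
    (k : R -> Omega -> option U) (U0 : set U) (H : R -> U -> Omega -> R)
    (t : R) (J : Omega -> R) : Prop :=
  measurable_fun setT J /\
  exists (p : nat -> nat) (h : forall j, 'I_(p j) -> step)
    (A : forall j, 'I_(p j) -> set U),
    [/\ forall j i, admissible F (h j i),
        forall j i,
          [/\ measurable (A j i), A j i `<=` U0 & (n (A j i) < +oo)%E],
        cvg0_in_prob (fun j w =>
          \int[(lebesgue_measure \x n)%E]_(z in `]0%R, t] `*` U0)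
            ((\sum_(i < p j) step_val (h j i) z.1 w * \1_(A j i) z.2
              - H z.1 z.2 w) ^+ 2)%:E)%E &
        cvg0_in_prob (fun j w => `|\sum_(i < p j) coef (h j i) w *
          compensated_pp k (Num.min (from (h j i)) t)
            (Num.min (upto (h j i)) t) (A j i) w - J w|%:E)].

(* int_0^{t+} int_V H(s, u) N(ds, du): sum over the jump times s <= t with
   k_s in V, almost surely finitely many when n V < +oo. *)
Definition jump_integral (d : nat) (k : R -> Omega -> option U) (V : set U)
    (H : R -> U -> Omega -> 'rV[R]_d) (t : R) (w : Omega) : 'rV[R]_d :=
  \sum_(s \in [set s : R | 0 < s /\ s <= t /\
                           exists2 u, k s w = Some u & V u])
    (if k s w is Some u then H s u w else 0).

(* X is a strong solution started at x, adapted to the P-augmentation of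
   (F_{<= t}) generated by the noise. *)
Record strong_solution (d : nat) (W : R -> Omega -> 'rV[R]_m)
    (k : R -> Omega -> option U) (U0 : set U)
    (b : 'rV[R]_d -> 'rV[R]_d) (sigma : 'rV[R]_d -> 'M[R]_(d, m))
    (f g : 'rV[R]_d -> U -> 'rV[R]_d)
    (x : 'rV[R]_d) (X : R -> Omega -> 'rV[R]_d) : Prop := {
  sol_adapted : forall t, 0 <= t ->
    sub_measurable (augment (noise_sigma W k `[0, t])) (X t);
  sol_cadlag : forall w, cadlag (fun t => X t w);
  sol_equation : forall t, 0 <= t ->
    let F r := augment (noise_sigma W k `[0, r]) in
    exists (I : 'I_d -> 'I_m -> Omega -> R) (J : 'I_d -> Omega -> R),
      [/\ forall i j, ito_integral F (fun s w => W s w 0 j)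
            (fun s w => sigma (X s w) i j) t (I i j),
          forall i, compensated_integral F k U0
            (fun s u w => f (left_lim (X ^~ w) s) u 0 i) t (J i) &
          {ae P, forall w, forall i : 'I_d,
            X t w 0 i = x 0 i
              + (\int[lebesgue_measure]_(s in `[0, t]) (b (X s w) 0 i))
              + \sum_j I i j w
              + J i w
              + jump_integral k (~` U0)
                  (fun s u w => g (left_lim (X ^~ w) s) u) t w 0 i}] }.

End noise.

Section dynamics.
Context (d : nat).
Implicit Types (theta : R -> Omega -> Omega)
  (phi : R -> Omega -> 'rV[R]_d -> 'rV[R]_d).

Record cadlag_rds theta phi : Prop := {
  rds_measurable : measurable_fun
    (`[0, +oo[ `*` setT : set (R * (Omega * 'rV[R]_d)))
    (fun z : R * (Omega * 'rV[R]_d) => phi z.1 z.2.1 z.2.2);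
  rds_homeo : forall t w, 0 <= t -> homeomorphism (phi t w);
  rds_cadlag : forall w x, cadlag (fun t => phi t w x);
  rds_id : forall w x, phi 0 w x = x;
  rds_cocycle : forall s t w x, 0 <= s -> 0 <= t ->
    phi (t + s) w x = phi t (theta s w) (phi s w x) }.

Definition skew_product theta phi (t : R) (z : Omega * 'rV[R]_d) :
  Omega * 'rV[R]_d := (theta t z.1, phi t z.1 z.2).

Definition invariant_measure theta phi
    (mu : probability (Omega * 'rV[R]_d)%type R) : Prop :=
  (forall A, measurable A -> mu (A `*` setT) = P A) /\
  (forall t, 0 <= t -> forall C, measurable C ->
     pushforward mu (skew_product theta phi t) C = mu C).

Definition factorization (mu : probability (Omega * 'rV[R]_d)%type R)
    (muw : R.-pker Omega ~> 'rV[R]_d) : Prop :=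
  forall C, measurable C ->
    mu C = (\int[P]_w muw w (xsection C w))%E.

Definition markov_measure (Finf F0 : set (set Omega))
    (muw : R.-pker Omega ~> 'rV[R]_d) : Prop :=
  exists Ninf N0 : Omega -> set 'rV[R]_d -> \bar R,
    [/\ is_condexp_measure Finf (fun w B => muw w B) Ninf,
        is_condexp_measure F0 (fun w B => muw w B) N0 &
        forall B, measurable B -> {ae P, forall w, Ninf w B = N0 w B}].

Definition transition phi (t : R) (x : 'rV[R]_d) (B : set 'rV[R]_d) : \bar R :=
  P [set w | B (phi t w x)].

Definition stationary_measure
    (p : R -> 'rV[R]_d -> set 'rV[R]_d -> \bar R)
    (nu : {measure set 'rV[R]_d -> \bar R}) : Prop :=
  forall t B, 0 < t -> measurable B -> (\int[nu]_x p t x B = nu B)%E.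

End dynamics.
End random.

(* Main.v *)
Require Import Defs.
From HB Require Import structures.
From mathcomp Require Import all_boot all_order all_algebra.
From mathcomp Require Import all_classical all_reals all_analysis.
From mathcomp Require Import measurable_realfun lra.

(* Since [W 0 = 0] almost surely, F_{=0} is P-trivial, so the Markov property
   makes E(mu_w B | F_{<oo}) equal almost surely to mubar B := E(mu_w B) = mu
   (Omega x B).  Hence mu = P x mubar on products of (P-augmented) F_{<oo} with
   the Borel sets; in particular E(mu_w | F_{>0}) = mubar.  The event
   {(w, x) | phi t w x \in B} lies in that product sigma-algebra, because
   phi t w x is adapted in w and continuous in x; its P x mubar measure is
   \int p_t(x, B) mubar(dx), and by invariance its mu measure is mubar B. *)

Set Implicit Arguments.
Unset Strict Implicit.
Unset Printing Implicit Defensive.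
Import Order.TTheory GRing.Theory Num.Theory.
Import numFieldNormedType.Exports.
Local Open Scope classical_set_scope.
Local Open Scope ring_scope.

(** With [c] the mean of [Y], the difference [Y - c] integrates to zero over every event of [G],
    since such an event is null or of full measure. The events [c <= Y] and [Y < c] belong to [G],
    so [|Y - c|] has integral zero. *)
Lemma zero_one_sigma_cst (R : realType) (dO : measure_display)
    (Omega : measurableType dO) (P : probability Omega R)
    (G : set (set Omega)) (Y : Omega -> \bar R) :
  G `<=` measurable -> (forall A, G A -> P A = 0%E \/ P A = 1%E) ->
  sub_measurable G Y -> P.-integrable setT Y ->
  {ae P, forall w, Y w = \int[P]_w' Y w'}%E.
Proof.
move=> Gm G01 GY iY; set c := (\int[P]_w Y w)%E.
have cfin : c \is a fin_num by exact: integrable_fin_num.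
have mY : measurable_fun setT Y := measurable_int P iY.
have ic : P.-integrable setT (cst c).
  by rewrite -(fineK cfin); apply: finite_measure_integrable_cst.
have iYc : P.-integrable setT (fun w => Y w - c)%E by exact: integrableB.
have mYc : measurable_fun setT (fun w => Y w - c)%E := measurable_int P iYc.
have intG A : G A -> (\int[P]_(w in A) (Y w - c) = 0)%E.
  move=> GA; have mA := Gm _ GA.
  have [PA|PA] := G01 _ GA.
    by rewrite null_set_integral//; exact: measurable_funS mYc.
  have PAC : P (~` A) = 0%E by rewrite probability_setC// PA subee.
  have -> : (\int[P]_(w in A) (Y w - c) = \int[P]_w (Y w - c))%E.
    rewrite (negligible_integral (measurableC mA) measurableT iYc PAC).
    by rewrite setDE setCK setTI.
  rewrite (integralB measurableT iY ic) [X in (_ - X)%E]integral_cst//=.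
  by rewrite (_ : P setT = 1%E) ?mule1 ?subee//; exact: probability_setT.
have GYp : G [set w | c <= Y w]%E.
  rewrite (_ : [set _ | _] = Y @^-1` `[c, +oo[%classic)//.
    by apply: GY; exact: emeasurable_itv.
  by apply/seteqP; split => w /=; rewrite in_itv/= andbT.
have GYn : G [set w | Y w < c]%E.
  rewrite (_ : [set _ | _] = Y @^-1` `]-oo, c[%classic)//.
  by apply: GY; exact: emeasurable_itv.
have : (\int[P]_w `|Y w - c| = 0)%E.
  rewrite (_ : setT = [set w | c <= Y w]%E `|` [set w | Y w < c]%E); last first.
    by apply/seteqP; split => // w _ /=; case: leP; [left|right].
  rewrite ge0_integral_setU; [|exact: Gm|exact: Gm| | by []|]; last 2 first.
  - by apply: measurableT_comp => //; exact: measurable_funS mYc.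
  - by apply/disj_setPS => w /= [/le_lt_trans h /h]; rewrite ltxx.
  rewrite (eq_integral (fun w => Y w - c)%E); last first.
    by move=> w /[!inE]/= cY; rewrite gee0_abs// sube_ge0// cfin.
  rewrite intG// add0e.
  rewrite (eq_integral (fun w => - (Y w - c))%E); last first.
    by move=> w /[!inE]/= cY; rewrite lte0_abs// sube_lt0// cfin orbT.
  rewrite integralN ?intG ?oppe0//.
  apply: integrable_add_def; first exact: Gm.
  exact: (integrableS measurableT (Gm _ GYn) (@subsetT _ _) iYc).
move=> /(ae_eq_integral_abs P measurableT mYc).
(* As [c] is finite, a vanishing extended-real difference rules out infinite values of [Y w] and
   forces equality. *)
apply: filterS => w /(_ I); rewrite -(fineK cfin).
by case: (Y w) => [y| |]//= [/subr0_eq ->].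
Qed.

Section null_symmetric_difference.
Context (R : realType) (d : measure_display) (T : measurableType d)
  (P : {measure set T -> \bar R}) (A B : set T)
  (mA : measurable A) (mB : measurable B) (AB : P.-negligible (A `+` B)).

(** The restrictions of [f] to [A] and to [B] can differ only on the null set [A + B] (symmetric
    difference). This replaces an augmented event by a genuine noise event under an integral. *)
Lemma integral_setY0 (f : T -> \bar R) : measurable_fun setT f ->
  (\int[P]_(x in A) f x = \int[P]_(x in B) f x)%E.
Proof.
move=> mf; rewrite integral_mkcond [RHS]integral_mkcond.
apply: ae_eq_integral => //; [apply/(measurable_restrictT f) => //;
  exact: measurable_funS mf..|].
apply: negligibleS AB => x; rewrite setY_def /= => h.
apply: contrapT => nY; apply: h => _; rewrite !patchE.
have [xA|xA] := boolP (x \in A); have [xB|xB] := boolP (x \in B) => //.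
- by exfalso; apply: nY; left; split; rewrite -?notin_setE//; exact/set_mem.
- by exfalso; apply: nY; right; split; rewrite -?notin_setE//; exact/set_mem.
Qed.

Lemma measure_setY0 : P A = P B.
Proof.
have := integral_setY0 (measurable_cst (1%E : \bar R)).
by rewrite !integral_cst// !mul1e.
Qed.

End null_symmetric_difference.

Section noise_sigma_algebras.
Context (R : realType) (m : nat) (dU : measure_display)
  (U : measurableType dU) (n : {sigma_finite_measure set U -> \bar R})
  (dO : measure_display) (Omega : measurableType dO) (P : probability Omega R)
  (W : R -> Omega -> 'rV[R]_m) (k : R -> Omega -> option U)
  (W_bm : standard_brownian P W) (k_poisson : stationary_poisson P n k).

Lemma noise_sigmaS (S T : set R) :
  S `<=` T -> noise_sigma W k S `<=` noise_sigma W k T.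
Proof.
move=> ST; apply: sub_sigma_algebra2 => E [[s Ss h]|[s Ss h]].
  by left; exists s => //; exact: ST.
by right; exists s => //; exact: ST.
Qed.

Lemma noise_sigma_measurable (T : set R) :
  T `<=` `[0, +oo[ -> noise_sigma W k T `<=` measurable.
Proof.
move=> T0; apply: smallest_sub; first exact: sigma_algebra_measurable.
move=> E [[s /T0]|[s _ [B mB [C mC ->]]]].
  rewrite /= in_itv/= andbT => s0 [A mA ->].
  by rewrite -[X in measurable X]setTI; exact: (bm_measurable W_bm s0).
rewrite -[X in measurable X]setTI; apply: (pp_measurable k_poisson) => //.
exact: measurableX.
Qed.

(** Events of probability 0 or 1 form a sigma-algebra: a countable union has a member of full
    measure or is a union of null sets. It contains the generators at time 0, because [W 0 = 0]
    almost surely and []0, 0]] is empty, so that the jump count is constantly 0. *)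
Lemma noise_sigma0_zero_one (A : set Omega) :
  noise_sigma W k `[0, 0] A -> P A = 0%E \/ P A = 1%E.
Proof.
move=> FA; have m0 : noise_sigma W k `[0, 0] `<=` measurable.
  by apply: noise_sigma_measurable => s /=; rewrite !in_itv/= andbT => /andP[].
suff : noise_sigma W k `[0, 0] `<=`
    [set A | measurable A /\ (P A = 0%E \/ P A = 1%E)] by move=> /(_ _ FA)[].
apply: smallest_sub; first split => /=.
- by split => //; left; exact: measure0.
- move=> B [mB PB]; rewrite setTD; split; first exact: measurableC.
  rewrite probability_setC//.
  by case: PB => ->; rewrite ?sube0 ?subee//; [right|left].
- move=> B mPB; have mB i : measurable (B i) by have [] := mPB i.
  have mU : measurable (\bigcup_i B i) by exact: bigcup_measurable.
  split => //; have [[i PBi]|/forallNP PB0] :=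
    pselect (exists i, P (B i) = 1%E).
    right; apply/eqP; rewrite eq_le probability_le1//= -PBi.
    by rewrite le_measure ?inE//; exact: bigcup_sup.
  left; apply: measure_negligible => //; apply: negligible_bigcup => i.
  by apply/negligibleP => //; have [_ []//] := mPB i; move/PB0.
- move=> E FE; split; first by apply: m0; exact: sub_sigma_algebra.
  case: FE => [[s]|[s]]; rewrite /= in_itv/= => /le_anti <-; last first.
    move=> [B mB [C mC ->]].
    rewrite set_itv_ge ?bnd_simp ?ltxx// set0X.
    have -> : (fun w => counting_pp k w set0) = cst 0%E.
      apply/funext => w; rewrite /counting_pp [X in counting X](_ : _ = set0).
        by rewrite measure0.
      by apply/seteqP; split => // s' [_ []].
    rewrite preimage_cst; case: ifP => _; last by left; exact: measure0.
    by right; exact: probability_setT.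
  move=> [A' mA' ->]; have mW : measurable (W 0 @^-1` A').
    rewrite -[X in measurable X]setTI.
    exact: (bm_measurable W_bm (lexx 0)).
  have [A'0|A'0] := pselect (A' 0).
    right; suff : P (~` (W 0 @^-1` A')) = 0%E.
      rewrite probability_setC// -(fineK (fin_num_measure P _ mW)).
      by move=> [/subr0_eq <-].
    apply: measure_negligible; first exact: measurableC.
    apply: negligibleS (bm_start W_bm) => w /= nA W0; apply: nA.
    by rewrite W0.
  left; apply: measure_negligible => //.
  by apply: negligibleS (bm_start W_bm) => w /= /[swap] ->.
Qed.

(** On an event of F_{<oo}, [muw w B] may be replaced under the integral by [Ninf w B], which equals
    [N0 w B] almost surely, and the latter is almost surely constant by the zero-one law. *)
Lemma markov_measure_indep (d : nat)
    (muw : R.-pker Omega ~> 'rV[R]_d) (A : set Omega) (B : set 'rV[R]_d) :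
  markov_measure P (noise_sigma W k `[0, +oo[) (noise_sigma W k `[0, 0]) muw ->
  augment P (noise_sigma W k `[0, +oo[) A -> measurable B ->
  (\int[P]_(w in A) muw w B = P A * \int[P]_w muw w B)%E.
Proof.
move=> [Ninf [N0 [Einf E0 EN]]] [mA [A' FA' AA']] mB.
have mmuw : measurable_fun setT (fun w => muw w B) by exact: measurable_kernel.
have m0 : noise_sigma W k `[0, 0] `<=` measurable.
  by apply: noise_sigma_measurable => s /=; rewrite !in_itv/= andbT => /andP[].
have minf : noise_sigma W k `[0, +oo[ `<=` measurable.
  exact: noise_sigma_measurable.
have mA' := minf _ FA'.
have [_ iNinf Ninfmu] := Einf B mB; have [GN0 iN0 N0mu] := E0 B mB.
have N0cst := zero_one_sigma_cst m0 noise_sigma0_zero_one GN0 iN0.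
(* The whole space is an event of F_{=0}, so conditioning keeps the mean; this identifies the
   constant. *)
have IN0 : (\int[P]_w N0 w B = \int[P]_w muw w B)%E.
  apply: N0mu; have [F0 FC _] := smallest_sigma_algebra setT
    (gen_W W `[0, 0] `|` gen_N k `[0, 0]).
  by have := FC _ F0; rewrite setD0.
rewrite (integral_setY0 mA mA' AA' mmuw) (measure_setY0 mA mA' AA').
rewrite -(Ninfmu _ FA').
rewrite (ae_eq_integral (cst (\int[P]_w muw w B)%E))//.
- by rewrite integral_cst// muleC.
- by apply: measurable_funS (measurable_int P iNinf).
- move: (EN B mB) N0cst; apply: filterS2 => w h1 h2 _ /=.
  by rewrite h1 h2.
Qed.

Lemma noise_sigma_augment (S T : set R) :
  S `<=` T -> T `<=` `[0, +oo[ ->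
  noise_sigma W k S `<=` augment P (noise_sigma W k T).
Proof.
move=> ST T0 A /(noise_sigmaS ST) FA; split.
  exact: noise_sigma_measurable FA.
by exists A => //; rewrite setYK; exact: negligible_set0.
Qed.

End noise_sigma_algebras.

(** The symmetric difference of two intersections lies in the union of the two symmetric
    differences. It makes the rectangles with augmented sides a pi-system. *)
Lemma augment_setI (R : realType) (dO : measure_display)
    (Omega : measurableType dO) (P : probability Omega R)
    (G : set (set Omega)) :
  setI_closed G -> setI_closed (augment P G).
Proof.
move=> GI A B [mA [A' GA' AA']] [mB [B' GB' BB']]; split.
  exact: measurableI.
exists (A' `&` B'); first exact: GI.
apply: negligibleS (negligibleU AA' BB') => w.
rewrite !setY_def => -[[[Aw Bw] nAB]|[[A'w B'w] nAB]].
  have [A'w|nA'w] := pselect (A' w); last by left; left.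
  by right; left; split => // B'w; exact: nAB.
have [Aw|nAw] := pselect (A w); last by left; right.
by right; right; split => // Bw; exact: nAB.
Qed.

Lemma augmentS (R : realType) (dO : measure_display)
    (Omega : measurableType dO) (P : probability Omega R)
    (G H : set (set Omega)) : G `<=` H -> augment P G `<=` augment P H.
Proof. by move=> GH A [mA [B /GH HB AB]]; split => //; exists B. Qed.

Lemma rV_rat_dense (R : realType) (d : nat) (x : 'rV[R]_d) (e : R) :
  0 < e -> exists q : 'rV[rat]_d, ball (map_mx ratr q : 'rV[R]_d) e x.
Proof.
move=> e0.
have /choice[q hq] : forall i, exists q : rat, ball (ratr q : R) e (x 0 i).
  move=> i; have /rat_in_itvoo[q] : x 0 i < x 0 i + e by rewrite ltrDl.
  rewrite in_itv/= => /andP[q1 q2]; exists q.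
  by rewrite /ball/= ltr_distl; apply/andP; split; lra.
exists (\row_i q i); split => // i j; rewrite !mxE ord1; exact: hq.
Qed.

(* For open [A], continuity in [x] gives [h w x \notin A] iff for every [j] some
   rational [q] within [1/(j+1)] of [x] has [h w q] within [1/(j+1)] of the
   complement of [A]. *)
Lemma caratheodory_measurable (R : realType) (d : nat) (Omega : Type)
    (G : set (set Omega)) (h : Omega -> 'rV[R]_d -> 'rV[R]_d)
    (B : set 'rV[R]_d) :
  (forall x A, measurable A -> G ((fun w => h w x) @^-1` A)) ->
  (forall w, continuous (h w)) -> measurable B ->
  <<s [set A `*` B | A in G & B in (@measurable _ 'rV[R]_d)] >>
    [set z | B (h z.1 z.2)].
Proof.
set S := <<s _ >>; move=> Gh ch.
have [S0 SC SU] : sigma_algebra setT S by exact: smallest_sigma_algebra.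
have openm (A : set 'rV[R]_d) : open A -> measurable A.
  by move=> oA; exact: sub_sigma_algebra.
pose E (B : set 'rV[R]_d) := [set z : Omega * 'rV[R]_d | B (h z.1 z.2)].
(* Preimages commute with the set operations, so the sets [A] with [S (E A)] form a sigma-algebra
   and open sets suffice. *)
suff opS A : open A -> S (E A).
  apply: (@smallest_sub _ _ _ [set A | S (E A)]) => //; split.
  - by rewrite /= (_ : E set0 = set0).
  - by move=> A SA /=; have := SC _ SA.
  - by move=> F SF /=; rewrite (_ : E _ = \bigcup_i E (F i)); [exact: SU|].
move=> oA; pose e j : R := j.+1%:R^-1.
have e0 j : 0 < e j by rewrite invr_gt0.
pose V j := \bigcup_(y in ~` A) ball y (e j).
have oV j : open (V j) by apply: bigcup_open => y _; exact: ball_open.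
pose r (q : 'rV[rat]_d) : 'rV[R]_d := map_mx ratr q.
(* The countable type of rational points is enumerated by [unpickle]; an index that codes no point
   contributes the empty set. *)
pose F j i := if @unpickle 'rV[rat]_d i is Some q
  then ((fun w => h w (r q)) @^-1` V j) `*` ball (r q) (e j) else set0.
have -> : E A = \bigcup_j (setT `\` \bigcup_i F j i).
  apply/seteqP; split => -[w x]; rewrite /E /=.
    move=> Ahx; move: (oA); rewrite openE => /(_ _ Ahx)/nbhs_ballP[a /= a0 aA].
    have a2 : 0 < a / 2 by rewrite divr_gt0.
    have /nbhs_ballP[c /= c0 ca] := ch w x _ (nbhsx_ballx _ _ a2).
    have b0 : 0 < Num.min (a / 2) c by rewrite lt_min c0 a2.
    (* For this [j], a point in some [F j i] would put [h w (r q)] within [a / 2] of both [h w x]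
       and some [y] outside [A], contradicting that the ball of radius [a] lies in [A]. *)
    have [j _ /(_ j (leqnn j)) /=] := near_infty_natSinv_lt (PosNum b0).
    rewrite lt_min => /andP[/ltW ja /ltW jc].
    exists j => //; split => // -[i _]; rewrite /F.
    case: unpickle => // q -[/= [y nAy hy] qx].
    apply: nAy; apply: aA; apply: (@ball_splitr _ _ (h w (r q))).
      by apply: ball_sym; apply: ca; apply/ball_sym; apply: le_ball qx.
    by apply: le_ball (ball_sym hy).
  move=> [j _ [_ nF]]; apply: contrapT => nA; apply: nF.
  have /nbhs_ballP[c /= c0 ca] := ch w x _ (nbhsx_ballx _ _ (e0 j)).
  have b0 : 0 < Num.min (e j) c by rewrite lt_min c0 e0.
  have [q qx] := rV_rat_dense x b0.
  exists (pickle q) => //; rewrite /F pickleK; split => /=.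
    exists (h w x) => //; apply: ca; apply/ball_sym.
    by apply: le_ball qx; rewrite ge_min lexx orbT.
  by apply: le_ball qx; rewrite ge_min lexx.
apply: (SU) => j; apply: (SC); apply: (SU) => i; rewrite /F.
case: unpickle => [q|]; last exact: S0.
apply: sub_sigma_algebra; exists ((fun w => h w (r q)) @^-1` V j).
  by apply: Gh; exact: openm.
by exists (ball (r q) (e j)) => //; apply: openm; exact: ball_open.
Qed.

Theorem lemma3p3 (R : realType) (d m : nat)
  (dU : measure_display) (U : measurableType dU)
  (n : {sigma_finite_measure set U -> \bar R}) (U0 : set U)
  (mU0 : measurable U0) (n_compl : (n (~` U0) < +oo)%E)
  (dO : measure_display) (Omega : measurableType dO) (P : probability Omega R)
  (W : R -> Omega -> 'rV[R]_m) (k : R -> Omega -> option U)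
  (W_bm : standard_brownian P W)
  (k_poisson : stationary_poisson P n k)
  (Wk_indep : independent_noise P W k)
  (theta : R -> Omega -> Omega)
  (theta_shift : noise_shift P W k theta)
  (b : 'rV[R]_d -> 'rV[R]_d) (sigma : 'rV[R]_d -> 'M[R]_(d, m))
  (f g : 'rV[R]_d -> U -> 'rV[R]_d)
  (mb : measurable_fun setT b) (msigma : measurable_fun setT sigma)
  (mf : measurable_fun setT (fun z : 'rV[R]_d * U => f z.1 z.2))
  (mg : measurable_fun setT (fun z : 'rV[R]_d * U => g z.1 z.2))
  (hb : cond_b b) (hsigma : cond_sigma sigma)
  (hf : cond_f n U0 f) (hg : cond_g U0 g)
  (phi : R -> Omega -> 'rV[R]_d -> 'rV[R]_d)
  (phi_solution : forall x,
     strong_solution P n W k U0 b sigma f g x (fun t w => phi t w x))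
  (phi_rds : cadlag_rds theta phi)
  (mu : probability (Omega * 'rV[R]_d)%type R)
  (muw : R.-pker Omega ~> 'rV[R]_d)
  (mu_inv : invariant_measure P theta phi mu)
  (mu_fact : factorization P mu muw)
  (mu_markov : markov_measure P
     (noise_sigma W k `[0, +oo[) (noise_sigma W k `[0, 0]) muw) :
  exists mubar : probability 'rV[R]_d R,
    is_condexp_measure P (noise_sigma W k `]0, +oo[)
      (fun w B => muw w B) (fun _ B => mubar B) /\
    stationary_measure (transition P phi) mubar.
Proof.
have indep A B :=
  markov_measure_indep W_bm k_poisson (A := A) (B := B) mu_markov.
(* Packing the projection as a measurable function makes the second marginal of [mu] a probability
   by construction. *)
pose sndm : {mfun (Omega * 'rV[R]_d)%type >-> 'rV[R]_d} :=
  HB.pack (@snd Omega 'rV[R]_d)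
    (isMeasurableFun.Build _ _ _ _ (@snd Omega 'rV[R]_d) measurable_snd).
pose mubar : probability 'rV[R]_d R := distribution mu sndm.
have msnd B : measurable B -> measurable ((@snd Omega 'rV[R]_d) @^-1` B).
  by move=> mB; rewrite -[X in measurable X]setTI; exact: measurable_snd.
have mubarE B : measurable B -> (mubar B = \int[P]_w muw w B)%E.
  move=> mB; rewrite /mubar /= /distribution /pushforward.
  rewrite mu_fact; last exact: msnd.
  by apply: eq_integral => w _; congr (muw w _); apply/seteqP; split => x;
    rewrite /xsection /= inE.
exists mubar; split.
  move=> B mB; have [F0 FC _] := smallest_sigma_algebra setT
    (gen_W W `]0, +oo[ `|` gen_N k `]0, +oo[).
  split.
  - move=> A mA; rewrite preimage_cst; case: ifP => _; last exact: F0.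
    by have := FC _ F0; rewrite setD0.
  - by rewrite -(fineK (fin_num_measure mubar B mB));
      exact: finite_measure_integrable_cst.
  - move=> A FA; have /indep/(_ mB) : augment P (noise_sigma W k `[0, +oo[) A.
      apply: (noise_sigma_augment W_bm k_poisson) FA => // s /=.
      by rewrite !in_itv/= !andbT => /ltW.
    have mA : measurable A.
      apply: (noise_sigma_measurable W_bm k_poisson) FA => s /=.
      by rewrite !in_itv/= !andbT => /ltW.
    by move=> ->; rewrite -mubarE// integral_cst// muleC.
move=> t B t0 mB.
(* The augmentation is needed here because solutions are adapted only to the augmented
   filtration. *)
pose G := augment P (noise_sigma W k `[0, +oo[).
pose C := [set A `*` B | A in G & B in (@measurable _ 'rV[R]_d)].
have GE : <<s C >> [set z : Omega * 'rV[R]_d | B (phi t z.1 z.2)].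
  apply: (caratheodory_measurable (h := phi t)) => // [x A mA|w].
    apply: augmentS (sol_adapted (phi_solution x) (ltW t0) mA).
    by apply: noise_sigmaS => s /=; rewrite !in_itv/= andbT => /andP[].
  by have [] := rds_homeo phi_rds w (ltW t0).
have Cm : C `<=` measurable.
  by move=> _ [A [mA _] [B' mB' <-]]; exact: measurableX.
have GT : G setT.
  apply: (noise_sigma_augment W_bm k_poisson (@subset_refl _ _)) => //.
  have [F0 FC _] := smallest_sigma_algebra setT
    (gen_W W `[0, +oo[ `|` gen_N k `[0, +oo[).
  by have := FC _ F0; rewrite setD0.
have CI : setI_closed C.
  move=> _ _ [A1 GA1 [B1 mB1 <-]] [A2 GA2 [B2 mB2 <-]].
  rewrite -setXI; exists (A1 `&` A2).
    apply: augment_setI => // X Y.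
    exact: (@measurableI _ (g_sigma_algebraType _)).
  by exists (B1 `&` B2) => //; exact: measurableI.
have muE : mu [set z | B (phi t z.1 z.2)] =
    (P \x^ mubar)%E [set z | B (phi t z.1 z.2)].
  (* Two finite measures that agree on a pi-system containing the whole space agree on the
     sigma-algebra it generates. On a rectangle, the factorization of [mu] and [indep] give the
     product value. *)
  apply: (g_sigma_algebra_measure_unique C Cm (fun=> setT)) GE => //.
  - by move=> _; exists setT => //; exists setT => //; rewrite setXTT.
  - by rewrite bigcup_const.
  - move=> _ [A GA [B' mB' <-]]; have [mA _] := GA.
    rewrite [RHS](_ : _ = P A * mubar B')%E; last exact: product_measure2E.
    rewrite mubarE// -indep//.
    apply: (eq_trans (mu_fact _ (measurableX mA mB'))).
    rewrite [RHS]integral_mkcond; apply: eq_integral => w _.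
    rewrite patchE; case: ifPn => wA.
      by rewrite in_xsectionX.
    by rewrite notin_xsectionX// measure0.
  - by move=> _; rewrite ltey_eq fin_num_measure.
(* The event is the preimage under the skew product of the cylinder over [B], so invariance gives it
   the mass [mubar B]. The product [\x^] integrates the [P]-measure of sections at fixed [x], which
   is [transition P phi t x B]. *)
apply: (@eq_trans _ _ (mu [set z | B (phi t z.1 z.2)])); last first.
  exact: mu_inv.2 _ (ltW t0) _ (msnd _ mB).
apply/esym/(eq_trans muE)/eq_integral => x _; congr (P _).
by apply/seteqP; split => w; rewrite /ysection /= inE.
Qed.
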